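(* Let $\epsilon>0$ and $i\in\mathbb{N}_0$. The $\tilde n_{\epsilon/2,i}$-stage optimal policy $\tilde\phi_{\tilde n_{\epsilon/2,i}}$ of the $\beta$-discounted auxiliary model defines an $\epsilon$-optimal policy $\phi^i_\epsilon\in\Phi$ for the non-discounted model with initial queue length $i$: with $\phi^i_\epsilon(j,1)=\tilde\phi_{\tilde n_{\epsilon/2,i}}(j)$ for all $j\in\mathbb{N}_0$ (and $\phi^i_\epsilon(j,0)=\mu$), one has $s^{\phi^i_\epsilon}(\delta_i)\ge s(\delta_i)-\epsilon$.
   Context: Model. Real parameters $\lambda,\beta>0$ and $0<\mu_1<\mu_2$ satisfy $\lambda+\mu_1+\mu_2+\beta=1$; service cost rates $0=c_{\mu_1}<c_{\mu_2}$; a fixed rate $\mu\in\{\mu_1,\mu_2\}$ with $\mu>\lambda$. The holding cost $h:\mathbb{N}_0\to\mathbb{R}$ satisfies $h(0)=0$, is non-negative, non-decreasing, convex, unbounded, and $\sum_{i\ge 0}h(i)x^i<\infty$ for all $0<x<1$. State space $S=\mathbb{N}_0\times\{0,1\}$. $\Phi$ is the set of stationary deterministic policies $\phi$, with $\phi(i,1)\in\{\mu_1,\mu_2\}$, $\phi(i,0)=\mu$. Transition probabilities $p^\phi_{xy}$: from $(i,1)$ with $a=\phi(i,1)$, to $(i+1,1)$ w.p. $\lambda$, to $(i,0)$ w.p. $\beta$, to $(i-1,1)$ w.p. $a\mathbf 1_{\{i>0\}}$, to $(i,1)$ otherwise; from $(i,0)$, to $(i+1,0)$ w.p. $\lambda$,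 to $(i-1,0)$ w.p. $\mu\mathbf 1_{\{i>0\}}$, to $(i,0)$ otherwise. Costs $c^\phi(i,1)=c_{\phi(i,1)}+h(i)$, $c^\phi(i,0)=c_\mu+h(i)$. Saved cost. For $\phi\in\Phi$ and $i\in\mathbb{N}_0$, $s^\phi(\delta_i)=\sum_{n\ge0}\big(\mathbb{E}[c^\phi(X_n)]-\mathbb{E}[c^\phi(Y_n)]\big)$, where $(X_n)$, $(Y_n)$ are the chains under $\phi$ started in $(i,0)$ and $(i,1)$ respectively; $s(\delta_i)=\sup_{\phi\in\Phi}s^\phi(\delta_i)$. Weight function. Fix $\zeta$ with $1<\zeta<1/(1-\beta)$, and in addition: if $\mu_1>\lambda$, $\zeta<\min\{\mu_1/\lambda,\,1+\beta/\lambda\}$; if $\mu_1\le\lambda<\mu_2$ (so $\mu=\mu_2$), $\zeta<\min\Big\{1+\frac\beta\lambda,\ \frac\mu\lambda,\ \frac{(\lambda+\frac12\beta+\mu_1)+\sqrt{(\lambda+\frac12\beta+\mu_1)^2-4\lambda\mu_1}}{2\lambda}\Big\}$. Let $M(i,0)=\frac12\zeta^i$, $M(i,1)=\zeta^i$, $\|f\|_M=\sup_{x\in S}|f(x)|/M(x)$, and $$\eta=1-\lambda+\lambda\zeta+\max\Big\{-\beta,\,-\big(1-\tfrac1\zeta\big)\mu,\,-\big(1-\tfrac1\zeta\big)\mu_1-\tfrac12\beta\Big\}<1.$$ Let $\rho_\mu=\lambda/\mu$ and $g^\ast=g_\mu=c_\mu+(1-\rho_\mu)\sum_{i\ge0}h(i)\rho_\mu^i$.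 $H^\ast:S\to\mathbb{R}$ is the unique function with $\|H^\ast\|_M<\infty$, $H^\ast(0,0)=0$ and $g^\ast+H^\ast(x)=\min_{\phi\in\Phi}\{c^\phi(x)+\sum_yp^\phi_{xy}H^\ast(y)\}$ for all $x\in S$. $u_M$ is a constant with $u_M\ge\max\{\sup_{\phi}\|c^\phi\|_M,\|g^\ast\mathbf 1\|_M\}$. $\beta$-discounted auxiliary model on $\mathbb{N}_0$: its Value Iteration is $V'_{\beta,0}\equiv0$ and $$V'_{\beta,n+1}(i)=\min_{a\in\{\mu_1,\mu_2\}}\big\{c_a+h(i)-g_\mu+\beta H^\ast(i,0)+a\mathbf 1_{\{i>0\}}V'_{\beta,n}(i-1)+(1-\beta-\lambda-a\mathbf 1_{\{i>0\}})V'_{\beta,n}(i)+\lambda V'_{\beta,n}(i+1)\big\}$$ (for $i=0$ the term with $V'_{\beta,n}(-1)$ is absent). The $n$-stage optimal policy $\tilde\phi_n$ ($n\ge1$) picks in each $i$ a minimising action $a$ in the formula defining $V'_{\beta,n}(i)$ from $V'_{\beta,n-1}$. For $\epsilon>0,k\in\mathbb{N}_0$, $$\tilde n_{\epsilon,k}=\Big\lceil\log_{(1-\beta)\zeta}\Big(\frac{\epsilon(1-(1-\beta)\zeta)}{\tilde K\zeta^k}\Big)\Big\rceil,\quad \tilde K=g_\mu+u_M+\frac{\beta u_M}{1-\eta},$$ read as $1$ if the formula gives a non-positive value. *)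

(* Defs.v *)
From HB Require Import structures.
From mathcomp Require Import all_boot all_order all_algebra.
From mathcomp Require Import all_classical all_reals.
From mathcomp Require Import ereal topology normedtype sequences exp.

Set Implicit Arguments.
Unset Strict Implicit.
Unset Printing Implicit Defensive.

Import Order.TTheory GRing.Theory Num.Theory.
Import numFieldNormedType.Exports.

Local Open Scope classical_set_scope.
Local Open Scope ring_scope.

(* Actions are identified with service rates, so [crate a] is the cost rate of
   serving at rate [a]; only its values at [mu1] and [mu2] matter. *)
Record model (R : realType) := Model {
  lambda : R;
  beta : R;
  mu1 : R;
  mu2 : R;
  mu : R;
  crate : R -> R;
  hcost : nat -> R;
  lambda_gt0 : 0 < lambda;
  beta_gt0 : 0 < beta;
  mu1_gt0 : 0 < mu1;
  mu1_lt_mu2 : mu1 < mu2;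
  rates_sum1 : lambda + mu1 + mu2 + beta = 1;
  crate_mu1 : crate mu1 = 0;
  crate_mu2_gt0 : 0 < crate mu2;
  mu_choice : mu = mu1 \/ mu = mu2;
  lambda_lt_mu : lambda < mu;
  hcost0 : hcost 0%N = 0;
  hcost_ge0 : forall i, 0 <= hcost i;
  hcost_nondecreasing : forall i j, (i <= j)%N -> hcost i <= hcost j;
  hcost_convex :
    forall i, hcost i.+1 - hcost i <= hcost i.+2 - hcost i.+1;
  hcost_unbounded : forall B : R, exists i, B < hcost i;
  hcost_pseries :
    forall x : R, 0 < x -> x < 1 -> cvgn (series (fun i => hcost i * x ^+ i))
}.

(* [(i, true)] is the state (i, 1) and [(i, false)] the state (i, 0). *)
Definition state := (nat * bool)%type.

Definition is_min (R : realType) (A : set R) (r : R) : Prop :=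
  A r /\ lbound A r.

Section Model.
Variables (R : realType) (m : model R).

Definition action : set R := [set a | a = mu1 m \/ a = mu2 m].

Definition Phi : set (state -> R) :=
  [set phi | (forall i, action (phi (i, true))) /\
             (forall i, phi (i, false) = mu m)].

(* The probability of staying put is what is left by the other transitions,
   e.g. 1 - lambda - beta - a in (i, 1) with i > 0. For i = 0, the truncated
   [i.-1] is harmless since its weight is 0. *)
Definition trans (phi : state -> R) (x y : state) : R :=
  let i := x.1 in
  if x.2 then
    let a := phi x in
    lambda m * (y == (i.+1, true))%:R + beta m * (y == (i, false))%:R
    + a * (0 < i)%N%:R * (y == (i.-1, true))%:R
    + (1 - lambda m - beta m - a * (0 < i)%N%:R) * (y == (i, true))%:R
  else
    lambda m * (y == (i.+1, false))%:R
    + mu m * (0 < i)%N%:R * (y == (i.-1, false))%:R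
    + (1 - lambda m - mu m * (0 < i)%N%:R) * (y == (i, false))%:R.

Definition cost (phi : state -> R) (x : state) : R :=
  crate m (if x.2 then phi x else mu m) + hcost m x.1.

(* [chain_law phi x n y] is the probability that the chain under [phi] started
   in [x] is in [y] at time [n]. The chain moves by at most one per step, so
   this and all sums over the state space below have finite support. *)
Fixpoint chain_law (phi : state -> R) (x : state) (n : nat) (y : state) : R :=
  if n is n'.+1 then
    \sum_(z \in [set: state]) chain_law phi x n' z * trans phi z y
  else (y == x)%:R.

Definition chain_expectation (phi : state -> R) (x : state) (n : nat)
    (f : state -> R) : R :=
  \sum_(y \in [set: state]) chain_law phi x n y * f y.

Definition saved_cost (phi : state -> R) (i : nat) : R :=
  limn (series (fun n => chain_expectation phi (i, false) n (cost phi)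
                         - chain_expectation phi (i, true) n (cost phi))).

Definition opt_saved_cost (i : nat) : \bar R :=
  ereal_sup [set (saved_cost phi i)%:E | phi in Phi].

Definition zeta_admissible (zeta : R) : Prop :=
  [/\ 1 < zeta, zeta < 1 / (1 - beta m),
      lambda m < mu1 m ->
        zeta < Num.min (mu1 m / lambda m) (1 + beta m / lambda m)
    & mu1 m <= lambda m -> lambda m < mu2 m ->
        let b := lambda m + beta m / 2 + mu1 m in
        zeta < Num.min (1 + beta m / lambda m) (Num.min (mu m / lambda m)
          ((b + Num.sqrt (b ^+ 2 - 4 * lambda m * mu1 m)) / (2 * lambda m)))].

Definition weight (zeta : R) (x : state) : R :=
  if x.2 then zeta ^+ x.1 else zeta ^+ x.1 / 2.

Definition Mnorm (zeta : R) (f : state -> R) : \bar R :=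
  ereal_sup [set (`|f x| / weight zeta x)%:E | x in [set: state]].

Definition eta (zeta : R) : R :=
  1 - lambda m + lambda m * zeta
  + Num.max (- beta m) (Num.max (- ((1 - 1 / zeta) * mu m))
                                (- ((1 - 1 / zeta) * mu1 m) - beta m / 2)).

Definition rho : R := lambda m / mu m.

Definition gstar : R :=
  crate m (mu m)
  + (1 - rho) * limn (series (fun i => hcost m i * rho ^+ i)).

Definition is_Hstar (zeta : R) (H : state -> R) : Prop :=
  [/\ (Mnorm zeta H < +oo)%E, H (0%N, false) = 0
    & forall x, is_min
        [set cost phi x + \sum_(y \in [set: state]) trans phi x y * H y
           | phi in Phi]
        (gstar + H x)].

Definition uM_bound (zeta uM : R) : Prop :=
  (Order.max (ereal_sup [set Mnorm zeta (cost phi) | phi in Phi])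
             (Mnorm zeta (fun=> gstar)) <= uM%:E)%E.

(* The expression minimised over [a] in the Value Iteration of the
   beta-discounted auxiliary model. *)
Definition auxQ (H : state -> R) (V : nat -> R) (i : nat) (a : R) : R :=
  crate m a + hcost m i - gstar + beta m * H (i, false)
  + a * (0 < i)%N%:R * V i.-1
  + (1 - beta m - lambda m - a * (0 < i)%N%:R) * V i
  + lambda m * V i.+1.

Fixpoint auxV (H : state -> R) (n : nat) (i : nat) : R :=
  if n is n'.+1 then
    Num.min (auxQ H (auxV H n') i (mu1 m)) (auxQ H (auxV H n') i (mu2 m))
  else 0.

(* [f] is an n-stage optimal policy for n >= 1; ties are broken arbitrarily. *)
Definition stage_optimal (H : state -> R) (n : nat) (f : nat -> R) : Prop :=
  (0 < n)%N /\
  forall i, action (f i) /\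
    forall a, action a ->
      auxQ H (auxV H n.-1) i (f i) <= auxQ H (auxV H n.-1) i a.

Definition logb (b x : R) : R := ln x / ln b.

Definition Ktilde (zeta uM : R) : R :=
  gstar + uM + beta m * uM / (1 - eta zeta).

Definition ntilde (zeta uM eps : R) (k : nat) : nat :=
  let r := (1 - beta m) * zeta in
  let z := Num.ceil (logb r (eps * (1 - r) / (Ktilde zeta uM * zeta ^+ k))) in
  if 0 < z then `|z|%N else 1%N.

Definition policy_of (f : nat -> R) : state -> R :=
  fun x => if x.2 then f x.1 else mu m.

End Model.

(* Main.v *)
Require Import Defs.
From mathcomp Require Import all_boot all_order all_algebra.
From mathcomp Require Import all_classical all_reals.
From mathcomp Require Import ereal topology normedtype sequences exp.
From mathcomp Require Import ring lra.

(* With W(i) = zeta^i, the auxiliary Bellman operators contract the W-norm with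
   factor (1 - beta) zeta < 1.  For a policy phi, the saved cost over horizon N
   is H(i, 0) - D_N(i), where D_N follows the value iteration of phi in the
   auxiliary model up to an error made of increments of E[H(X_N)] in the queue
   length.  These increments evolve under the level-0 chain killed at 0, so they
   vanish geometrically; hence s^phi(delta_i) = H(i, 0) - w^phi(i), with w^phi
   the fixed point of the auxiliary operator of phi.  Both w^phi (from below)
   and the fixed point of the n-stage optimal policy (from above) are within
   ((1 - beta) zeta)^n K W / (1 - (1 - beta) zeta) of V'_n, where K bounds the
   first iterates; n is chosen so that this is at most eps / 2. *)

Import Order.TTheory GRing.Theory Num.Theory.
Import numFieldNormedType.Exports.

Local Open Scope ring_scope.

Set Implicit Arguments.
Unset Strict Implicit.

(** * Two limit arguments on real sequences with geometric error *)

Lemma geometric_increments_cvg (R : realType) (u : nat -> R) (C q : R) :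
  0 <= q -> q < 1 -> (forall n, `|u n.+1 - u n| <= C * q ^+ n) ->
  cvgn u /\ `|limn u - u 0%N| <= C / (1 - q).
Proof.
move=> q0 q1 hu.
have q1' : 1 - q != 0 by rewrite subr_eq0 eq_sym lt_eqF.
have C0 : 0 <= C by have := hu 0%N; rewrite expr0 mulr1; apply: le_trans.
(* The tail of the geometric majorant: [u - e] is non-decreasing and [u + e] non-increasing, so
   monotone convergence yields the limit and both bounds on it. *)
pose e n := C / (1 - q) * q ^+ n.
have eS n : e n.+1 = e n - C * q ^+ n by rewrite /e exprS; field.
have e0 n : 0 <= e n.
  by rewrite mulr_ge0 ?exprn_ge0 ?divr_ge0 ?subr_ge0 ?(ltW q1).
have up n : u n + e n <= u 0%N + e 0%N.
  elim: n => // n; apply: le_trans.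
  by have := hu n; rewrite eS ler_norml => /andP[]; lra.
have dn n : u 0%N - e 0%N <= u n - e n.
  elim: n => // n /le_trans; apply.
  by have := hu n; rewrite eS ler_norml => /andP[]; lra.
have ecvg : (e @ \oo --> 0)%classic.
  by apply: (@cvg_geometric R (C / (1 - q)) q); rewrite ger0_norm.
have vcvg : cvgn (fun n => u n - e n).
  apply: nondecreasing_is_cvgn.
    apply/nondecreasing_seqP => n.
    by have := hu n; rewrite eS ler_norml => /andP[]; lra.
  exists (u 0%N + e 0%N) => _ [n _ <-].
  by have := up n; have := e0 n; lra.
have ucvg : cvgn u.
  have -> : u = (fun n => (u n - e n) + e n) by apply: funext => n; rewrite subrK.
  by apply: is_cvgD => //; apply/cvg_ex; exists 0.
split=> //.
have e0E : e 0%N = C / (1 - q) by rewrite /e expr0 mulr1.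
rewrite -e0E ler_distl; apply/andP; split.
- apply: limr_ge => //; apply: nearW => n; have := dn n; have := e0 n; lra.
- apply: limr_le => //; apply: nearW => n; have := up n; have := e0 n; lra.
Qed.

(** An a priori bound [B] improves itself to [a + q * B]; repetition gives
    [a / (1 - q) + B * q ^+ n], and [n] tends to infinity. Some finite [B] is required to start. *)
Lemma contraction_bound (R : realType) (I : Type) (v W : I -> R) (a q : R) :
  0 <= a -> 0 <= q -> q < 1 -> (forall i, 0 <= W i) ->
  (exists2 B, 0 <= B & forall i, `|v i| <= B * W i) ->
  (forall B, 0 <= B -> (forall i, `|v i| <= B * W i) ->
     forall i, `|v i| <= (a + q * B) * W i) ->
  forall i, `|v i| <= a / (1 - q) * W i.
Proof.
move=> a0 q0 q1 W0 [B B0 hB] hv i.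
have q1' : 1 - q != 0 by rewrite subr_eq0 eq_sym lt_eqF.
have aq0 : 0 <= a / (1 - q) by rewrite divr_ge0 ?subr_ge0 ?(ltW q1).
have hn n : forall i, `|v i| <= (a / (1 - q) + B * q ^+ n) * W i.
  elim: n => [|n IH] j.
    by rewrite expr0 mulr1 (le_trans (hB j)) // ler_wpM2r // lerDr.
  have := hv _ (addr_ge0 aq0 (mulr_ge0 B0 (exprn_ge0 n q0))) IH j.
  by congr (_ <= _ * _); rewrite exprS; field.
have lim : ((fun n => (a / (1 - q) + B * q ^+ n) * W i) @ \oo -->
    (a / (1 - q) + 0) * W i)%classic.
  apply: cvgM; last exact: cvg_cst.
  apply: cvgD; first exact: cvg_cst.
  by apply: (@cvg_geometric R B q); rewrite ger0_norm.
rewrite addr0 in lim.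
rewrite -(cvg_lim (@Rhausdorff R) lim); apply: limr_ge; first exact: cvgP lim.
by apply: nearW => n; exact: hn.
Qed.

(** * Expectations along the chain as iterates of a one-step operator *)

Section ChainLaw.
Variables (R : realType) (m : model R).

(** The transition kernel acting on functions, in closed form so that ring and linear arithmetic
    apply to it directly. *)
Definition step (phi f : state -> R) (x : state) : R :=
  let i := x.1 in
  if x.2 then
    lambda m * f (i.+1, true) + beta m * f (i, false)
    + phi x * (0 < i)%N%:R * f (i.-1, true)
    + (1 - lambda m - beta m - phi x * (0 < i)%N%:R) * f (i, true)
  else
    lambda m * f (i.+1, false) + mu m * (0 < i)%N%:R * f (i.-1, false)
    + (1 - lambda m - mu m * (0 < i)%N%:R) * f (i, false).

(** Finite sets exhausting the state space; they turn the finitely supported sums into ordinary big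
    sums, where exchange is available. *)
Definition box (N : nat) : seq state :=
  [seq (j, b) | j <- iota 0 N.+1, b <- [:: true; false]].

Lemma mem_box N x : (x \in box N) = (x.1 <= N)%N.
Proof.
case: x => j b; apply/allpairsP/idP => [[[k c] [+ _ [-> _]]]|jN].
  by rewrite mem_iota.
exists (j, b); split; [|by case: (b)|by []].
by rewrite mem_iota.
Qed.

Lemma box_uniq N : uniq (box N).
Proof.
by apply: allpairs_uniq; rewrite ?iota_uniq // => -[a b] [c d] _ _ /= [-> ->].
Qed.

Lemma fsum_box (F : state -> R) N :
  (forall y, (N < y.1)%N -> F y = 0) ->
  \sum_(y \in [set: state]) F y = \sum_(y <- box N) F y.
Proof.
move=> F0; rewrite (fsbigE (box N)) ?box_uniq //.
  by apply: eq_bigl => y; rewrite in_setT.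
by move=> y _; rewrite mem_box -ltnNge => /F0.
Qed.

Lemma sum_box_delta (c : R) (a : state) (f : state -> R) N :
  (a.1 <= N)%N -> \sum_(y <- box N) c * (y == a)%:R * f y = c * f a.
Proof.
move=> aN; rewrite (bigD1_seq a) ?mem_box ?box_uniq //= eqxx mulr1.
by rewrite big1 ?addr0 // => y /negPf ->; rewrite mulr0 mul0r.
Qed.

Lemma sum_trans_box phi f x N : (x.1 < N)%N ->
  \sum_(y <- box N) trans m phi x y * f y = step phi f x.
Proof.
move=> xN; have xN' := ltnW xN.
have pN : (x.1.-1 <= N)%N by rewrite (leq_trans (leq_pred _)).
rewrite /trans /step /=; case: x.2.
  (* The probability of staying is made opaque, so that [mulrDl] splits the kernel into its four
     transitions and no further. *)
  move: (1 - _ - _ - _) => e.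
  by under eq_bigr do rewrite !mulrDl; rewrite !big_split /= !sum_box_delta.
move: (1 - _ - _) => e.
by under eq_bigr do rewrite !mulrDl; rewrite !big_split /= !sum_box_delta.
Qed.

Lemma trans_support phi x y : (x.1.+1 < y.1)%N -> trans m phi x y = 0.
Proof.
case: x => i b; case: y => j c /= ij.
have neq k d : (k <= i.+1)%N -> ((j, c) == (k, d)) = false.
  by move=> ki; apply/eqP => -[jk _]; move: ij; rewrite jk ltnNge ki.
have ip : (i.-1 <= i.+1)%N by rewrite (leq_trans (leq_pred _)).
by rewrite /trans /= !neq // !mulr0 !addr0 if_same.
Qed.

Lemma sum_trans phi f x :
  \sum_(y \in [set: state]) trans m phi x y * f y = step phi f x.
Proof.
rewrite (@fsum_box _ x.1.+1) ?sum_trans_box // => y xy.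
by rewrite trans_support ?mul0r.
Qed.

Lemma chain_law_support phi x n y :
  (x.1 + n < y.1)%N -> chain_law m phi x n y = 0.
Proof.
elim: n y => [|n IH] y /= xy.
  by case: eqP xy => // ->; rewrite addn0 ltnn.
rewrite (@fsum_box _ (x.1 + n)); last by move=> z /IH ->; rewrite mul0r.
rewrite big_seq big1 // => z; rewrite mem_box => zn.
rewrite trans_support ?mulr0 // (leq_trans _ xy) //.
by rewrite addnS !ltnS.
Qed.

Lemma chain_expectation_box phi x n f N : (x.1 + n <= N)%N ->
  chain_expectation m phi x n f = \sum_(y <- box N) chain_law m phi x n y * f y.
Proof.
move=> xN; apply: fsum_box => y yN.
by rewrite chain_law_support ?mul0r // (leq_ltn_trans xN).
Qed.

(** [chain_law] appends its transitions at the end; exchanging the two finite sums lets the last one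
    act on [f]. *)
Lemma chain_expectationS phi x n f :
  chain_expectation m phi x n.+1 f = chain_expectation m phi x n (step phi f).
Proof.
rewrite (@chain_expectation_box _ _ _ _ (x.1 + n.+1)) //.
rewrite (@chain_expectation_box _ _ _ _ (x.1 + n)) //=.
under eq_bigr => y _.
  rewrite (@fsum_box _ (x.1 + n)); last first.
    by move=> z /chain_law_support ->; rewrite mul0r.
  rewrite big_distrl /=; over.
rewrite exchange_big /= big_seq [RHS]big_seq; apply: eq_bigr => z.
rewrite mem_box => zn; under eq_bigr do rewrite -mulrA.
by rewrite -big_distrr /= sum_trans_box // addnS ltnS.
Qed.

Lemma chain_expectation_iter phi x n f :
  chain_expectation m phi x n f = iter n (step phi) f x.
Proof.
elim: n f => [|n IH] f; last by rewrite chain_expectationS IH -iterSr.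
rewrite (@chain_expectation_box _ _ _ _ x.1) ?addn0 //= -[f x]mul1r.
rewrite -(@sum_box_delta 1 x f x.1) //.
by apply: eq_bigr => y _; rewrite mul1r.
Qed.

Lemma stepD phi f g x :
  step phi (fun y => f y + g y) x = step phi f x + step phi g x.
Proof. by rewrite /step; case: x.2; ring. Qed.

(** First-step analysis: finite-horizon total costs obey the value iteration of [phi]. *)
Lemma sum_chain_expectationS phi f N x :
  \sum_(0 <= n < N.+1) chain_expectation m phi x n f =
  f x + step phi (fun y => \sum_(0 <= n < N) chain_expectation m phi y n f) x.
Proof.
elim: N x => [|N IH] x.
  rewrite big_nat1 (chain_expectation_iter _ _ 0) /=.
  under [X in step _ X]funext do rewrite big_geq //.
  by rewrite /step; case: x.2; ring.
rewrite big_nat_recr //= IH -addrA; congr (_ + _).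
under [X in _ = step _ X x]funext do rewrite big_nat_recr //=.
rewrite stepD; congr (_ + _); rewrite chain_expectation_iter /=.
by congr step; apply: funext => y; rewrite chain_expectation_iter.
Qed.

End ChainLaw.

(** * Consequences of the admissibility of [zeta] *)

Section Weights.
Variables (R : realType) (m : model R) (zeta : R).
Hypothesis Hzeta : zeta_admissible m zeta.

Lemma action_bounds a : action m a -> mu1 m <= a <= mu2 m.
Proof.
by have := mu1_lt_mu2 m => /ltW ? [] ->; rewrite lexx ?andbT.
Qed.

Lemma action_mu : action m (mu m).
Proof. exact: mu_choice. Qed.

Lemma zeta_gt1 : 1 < zeta.
Proof. by case: Hzeta. Qed.

Lemma zetaX_gt0 i : 0 < zeta ^+ i.
Proof. by rewrite exprn_gt0 // (lt_trans _ zeta_gt1). Qed.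

Lemma zetaX_ge1 i : 1 <= zeta ^+ i.
Proof. by rewrite exprn_ege1 // ltW // zeta_gt1. Qed.

Definition disc : R := (1 - beta m) * zeta.

Lemma disc_gt0 : 0 < disc.
Proof.
have := zeta_gt1; have := rates_sum1 m; have := lambda_gt0 m.
have := mu1_gt0 m; have := mu1_lt_mu2 m => *.
by rewrite mulr_gt0; lra.
Qed.

Lemma disc_lt1 : disc < 1.
Proof.
case: Hzeta => z1 zb _ _; have := rates_sum1 m; have := lambda_gt0 m.
have := mu1_gt0 m; have := mu1_lt_mu2 m => *.
by move: zb; rewrite /disc ltr_pdivlMr 1?mulrC //; lra.
Qed.

Lemma lambda_zeta_lt_mu : lambda m * zeta < mu m.
Proof.
case: Hzeta => _ _ h1 h2; have l0 := lambda_gt0 m; have lm := lambda_lt_mu m.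
have m12 := mu1_lt_mu2 m.
rewrite mulrC -ltr_pdivlMr //; have [lm1|m1l] := ltP (lambda m) (mu1 m).
  have := h1 lm1; rewrite lt_min => /andP[z1 _]; apply: lt_le_trans z1 _.
  rewrite ler_pM2r ?invr_gt0 //.
  by have [->|->] := mu_choice m => //; apply: ltW.
have lm2 : lambda m < mu2 m by have [E|<-] := mu_choice m => //; lra.
by have := h2 m1l lm2; rewrite /= !lt_min => /and3P[].
Qed.

(** The three arguments of the maximum need, in turn, [zeta < 1 + beta m / lambda m],
    [lambda m * zeta < mu m], and negativity at [zeta] of the quadratic in [main], which is the
    third inequality multiplied by [zeta]. *)
Lemma eta_lt1 : eta m zeta < 1.
Proof.
have z1 := zeta_gt1; have z0 : 0 < zeta by lra.
have lz := lambda_zeta_lt_mu; have l0 := lambda_gt0 m.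
have m10 := mu1_gt0 m; have b0 := beta_gt0 m; have m12 := mu1_lt_mu2 m.
have lm := lambda_lt_mu m.
case: Hzeta => _ _ h1 h2.
have main : zeta < 1 + beta m / lambda m /\
    lambda m * zeta ^+ 2 - (lambda m + beta m / 2 + mu1 m) * zeta + mu1 m < 0.
  have [lm1|m1l] := ltP (lambda m) (mu1 m).
    have := h1 lm1; rewrite lt_min ltr_pdivlMr // => /andP[zl ->]; split=> //.
    have : 0 < (zeta - 1) * (mu1 m - zeta * lambda m) by rewrite mulr_gt0 ?subr_gt0.
    by have : 0 < beta m * zeta by [rewrite mulr_gt0]; nra.
  have lm2 : lambda m < mu2 m by have [E|<-] := mu_choice m => //; lra.
  have := h2 m1l lm2; rewrite /= !lt_min => /and3P[-> _ zr]; split=> //.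
  move: zr; set b := _ + _ + mu1 m; rewrite ltr_pdivlMr ?mulr_gt0 // => zr.
  set D := b ^+ 2 - 4 * lambda m * mu1 m in zr *.
  have D0 : 0 <= D.
    have -> : D = (lambda m - mu1 m) ^+ 2
        + beta m * (lambda m + mu1 m) + (beta m / 2) ^+ 2.
      by rewrite /D /b; field.
    by rewrite !addr_ge0 ?sqr_ge0 // mulr_ge0 //; lra.
  have s0 := sqrtr_ge0 D; have sD := sqr_sqrtr D0.
  (* 1 lies strictly between the two roots of the quadratic *)
  have bs : b - Num.sqrt D < 2 * lambda m.
    rewrite ltrBlDr -ltrBlDl; have [neg|pos] := ltP (b - 2 * lambda m) 0.
      by lra.
    rewrite -(@ltr_pXn2r _ 2) ?nnegrE // sD /D /b.
    by have : 0 < lambda m * beta m by [rewrite mulr_gt0]; nra.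
  (* As [zeta] exceeds 1, it also lies strictly between the roots; this product is the factored
     quadratic times [- (4 * lambda m)]. *)
  have : 0 < (2 * lambda m * zeta - (b - Num.sqrt D))
           * (b + Num.sqrt D - 2 * lambda m * zeta).
    rewrite mulr_gt0 //; last by lra.
    by have : lambda m < lambda m * zeta by [rewrite ltr_pMr]; lra.
  rewrite (_ : _ * _ = - (4 * lambda m)
      * (lambda m * zeta ^+ 2 - b * zeta + mu1 m)); last first.
    rewrite [LHS](_ : _ = Num.sqrt D ^+ 2 - (2 * lambda m * zeta - b) ^+ 2); last by ring.
    by rewrite sD /D; ring.
  by rewrite mulNr oppr_gt0 pmulr_rlt0 // mulr_gt0.
case: main => zb quad.
rewrite /eta -ltrBrDl !gt_max; apply/and3P; split.
- by move: zb; rewrite -ltrBlDl ltr_pdivlMr //; lra.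
- have -> : - ((1 - 1 / zeta) * mu m) = (- (zeta - 1) * mu m) / zeta.
    by field; rewrite gt_eqF.
  by rewrite ltr_pdivrMr //; nra.
- have -> : - ((1 - 1 / zeta) * mu1 m) - beta m / 2
      = (- (zeta - 1) * mu1 m - beta m / 2 * zeta) / zeta.
    by field; rewrite gt_eqF.
  by rewrite ltr_pdivrMr //; nra.
Qed.

(** The expected factor by which one step of the level-0 chain scales [zeta ^+ i] away from the
    origin. Choosing the second argument of the maximum in [eta] gives exactly this value. *)
Definition kill : R := lambda m * zeta + mu m / zeta + (1 - lambda m - mu m).

Lemma kill_ge0 : 0 <= kill.
Proof.
have := lambda_gt0 m; have := lambda_lt_mu m; have := zeta_gt1.
have := rates_sum1 m; have := beta_gt0 m; have := mu1_gt0 m.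
have /andP[_] := action_bounds action_mu => *.
have rest : 0 <= 1 - lambda m - mu m by lra.
by rewrite /kill addr_ge0 // addr_ge0 // ?divr_ge0 ?mulr_ge0 //; lra.
Qed.

Lemma kill_le_eta : kill <= eta m zeta.
Proof.
have z1 := zeta_gt1.
have -> : kill = 1 - lambda m + lambda m * zeta - (1 - 1 / zeta) * mu m.
  by rewrite /kill; field; lra.
by rewrite lerD2l !le_max lexx orbT.
Qed.

Lemma kill_lt1 : kill < 1.
Proof. exact: le_lt_trans kill_le_eta eta_lt1. Qed.

(* The increments of [f] evolve under the level-0 chain killed at the origin,
   for which the weight [zeta ^+ i] is strictly superharmonic. *)
Lemma step_increment_bound phi f B : 0 <= B ->
  (forall i, `|f (i.+1, false) - f (i, false)| <= B * zeta ^+ i) ->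
  forall i, `|step m phi f (i.+1, false) - step m phi f (i, false)|
            <= kill * B * zeta ^+ i.
Proof.
move=> B0 hf i; have z1 := zeta_gt1.
have l0 := lambda_gt0 m; have lm := lambda_lt_mu m; have sum1 := rates_sum1 m.
have b0 := beta_gt0 m; have m10 := mu1_gt0 m.
have /andP[_ mm2] := action_bounds action_mu.
have hd k c : 0 <= c -> c * `|f (k.+1, false) - f (k, false)| <= c * (B * zeta ^+ k).
  by move=> c0; rewrite ler_wpM2l.
have rest0 : 0 <= 1 - lambda m - mu m by lra.
case: i => [|j].
  (* A service at level 1 and an idle one at level 0 both end in 0, so the increment is lost with
     probability [mu m]: this is the killing. *)
  rewrite (_ : _ - _ = lambda m * (f (2%N, false) - f (1%N, false))
      + (1 - lambda m - mu m) * (f (1%N, false) - f (0%N, false))); last first.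
    by rewrite /step /=; ring.
  apply: le_trans (ler_normD _ _) _; rewrite !normrM (ger0_norm (ltW l0)).
  rewrite (ger0_norm rest0).
  apply: le_trans (lerD (hd _ _ (ltW l0)) (hd _ _ rest0)) _.
  rewrite expr1 expr0 /kill.
  have : 0 <= mu m / zeta * B by rewrite mulr_ge0 // divr_ge0; lra.
  by lra.
rewrite (_ : _ - _ = lambda m * (f (j.+3, false) - f (j.+2, false))
    + mu m * (f (j.+1, false) - f (j, false))
    + (1 - lambda m - mu m) * (f (j.+2, false) - f (j.+1, false))); last first.
  by rewrite /step /=; ring.
have mu0 : 0 <= mu m by lra.
apply: le_trans (ler_normD _ _) _; apply: le_trans (lerD (ler_normD _ _) (lexx _)) _.
rewrite !normrM (ger0_norm (ltW l0)) (ger0_norm rest0) (ger0_norm mu0).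
apply: le_trans (lerD (lerD (hd _ _ (ltW l0)) (hd _ _ mu0)) (hd _ _ rest0)) _.
rewrite le_eqVlt; apply/orP; left; apply/eqP.
by rewrite /kill !exprS; field; lra.
Qed.

(** * Weighted contraction of the auxiliary operators *)

Variable H : state -> R.

(** The coefficients of [V] are non-negative with sum [1 - beta m], and one move raises the weight
    by at most a factor [zeta]. The one-sided form is what comparing minima requires. *)
Lemma auxQ_contract V V' B a i : 0 <= B -> action m a ->
  (forall j, V j - V' j <= B * zeta ^+ j) ->
  auxQ m H V i a - auxQ m H V' i a <= disc * B * zeta ^+ i.
Proof.
move=> B0 /action_bounds/andP[a1 a2] hV; have z1 := zeta_gt1.
have l0 := lambda_gt0 m; have sum1 := rates_sum1 m.
have b0 := beta_gt0 m; have m10 := mu1_gt0 m.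
have hd k c : 0 <= c -> c * (V k - V' k) <= c * (B * zeta ^+ k).
  by move=> c0; rewrite ler_wpM2l.
have slack : 0 <= (1 - beta m - lambda m) * (zeta - 1) by rewrite mulr_ge0; lra.
case: i => [|j].
  rewrite (_ : _ - _ = (1 - beta m - lambda m) * (V 0%N - V' 0%N)
      + lambda m * (V 1%N - V' 1%N)); last by rewrite /auxQ /=; ring.
  apply: le_trans (lerD (hd _ _ _) (hd _ _ (ltW l0))) _; first by lra.
  rewrite expr0 expr1 /disc; have := mulr_ge0 B0 slack; lra.
rewrite (_ : _ - _ = a * (V j - V' j) + (1 - beta m - lambda m - a)
    * (V j.+1 - V' j.+1) + lambda m * (V j.+2 - V' j.+2)); last first.
  by rewrite /auxQ /=; ring.
apply: le_trans (lerD (lerD (hd _ _ _) (hd _ _ _)) (hd _ _ (ltW l0))) _; try lra.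
have BX : 0 <= B * zeta ^+ j by rewrite mulr_ge0 // ltW // zetaX_gt0.
rewrite /disc !exprS -subr_ge0 (_ : _ - _ = (zeta - 1)
    * (a + zeta * (1 - beta m - lambda m)) * (B * zeta ^+ j)); last by ring.
by rewrite mulr_ge0 // mulr_ge0 //; [lra|nra].
Qed.

Lemma auxQ_contract_norm V V' B a i : 0 <= B -> action m a ->
  (forall j, `|V j - V' j| <= B * zeta ^+ j) ->
  `|auxQ m H V i a - auxQ m H V' i a| <= disc * B * zeta ^+ i.
Proof.
move=> B0 ha hV; rewrite ler_norml; apply/andP; split.
- rewrite lerNl opprB auxQ_contract // => j.
  by apply: le_trans (hV j); rewrite distrC ler_norm.
- by rewrite auxQ_contract // => j; apply: le_trans (hV j); rewrite ler_norm.
Qed.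

Lemma Mnorm_le f u : (Mnorm zeta f <= u%:E)%E ->
  forall x, `|f x| <= u * weight zeta x.
Proof.
move=> fu x; have w0 : 0 < weight zeta x.
  by rewrite /weight; case: x.2; rewrite ?divr_gt0 ?zetaX_gt0.
rewrite -ler_pdivrMr // -lee_fin; apply: le_trans fu.
by apply: ereal_sup_ubound; exists x.
Qed.

End Weights.

(** * The saved cost of a policy through a fixed point of its auxiliary operator *)

Section AuxiliaryModel.
Variables (R : realType) (m : model R) (zeta : R) (H : state -> R).
Hypotheses (Hzeta : zeta_admissible m zeta) (HH : is_Hstar m zeta H).

(** No decision is taken in [(i, false)], so the minimum over policies is the same expression for
    every [phi]. *)
Lemma poisson phi i :
  gstar m + H (i, false) = cost m phi (i, false) + step m phi H (i, false).
Proof.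
have [_ _ /(_ (i, false))[[psi _ /= <-] _]] := HH.
by rewrite sum_trans.
Qed.

(** Only a qualitative bound, read off the finiteness of the norm; it starts the iteration that
    yields the explicit constant in [Hstar_bound]. *)
Lemma H_bound : exists2 C, 0 <= C & forall i, `|H (i, false)| <= C * zeta ^+ i.
Proof.
have [+ _ _] := HH; case E : (Mnorm zeta H) => [u||] // _.
- have hu := @Mnorm_le _ _ _ Hzeta H u; rewrite E lexx in hu.
  have u0 : 0 <= u / 2.
    have := le_trans (normr_ge0 _) (hu isT (0%N, false)).
    by rewrite /weight /= expr0; lra.
  exists (u / 2) => // i; apply: le_trans (hu isT (i, false)) _.
  by rewrite /weight /=; lra.
- have := @Mnorm_le _ _ _ Hzeta H 0; rewrite E leNye => /(_ isT) hu.
  exists 0 => // i; apply: le_trans (hu (i, false)) _.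
  by rewrite !mul0r.
Qed.

Lemma H_increment_bound phi : exists2 C, 0 <= C & forall N i,
  `|iter N (step m phi) H (i.+1, false) - iter N (step m phi) H (i, false)|
  <= C * kill m zeta ^+ N * zeta ^+ i.
Proof.
have [C C0 hC] := H_bound; have z1 := zeta_gt1 Hzeta.
have CB0 : 0 <= C * (zeta + 1) by rewrite mulr_ge0 //; lra.
exists (C * (zeta + 1)) => //; elim=> [|N IH] i.
  rewrite expr0 mulr1 /=; apply: le_trans (ler_normB _ _) _.
  by apply: le_trans (lerD (hC _) (hC _)) _; rewrite exprS; lra.
rewrite exprS mulrCA; apply: step_increment_bound => //.
by rewrite mulr_ge0 // exprn_ge0 // kill_ge0.
Qed.

Lemma action_dist_le1 a b : action m a -> action m b -> `|a - b| <= 1.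
Proof.
move=> /action_bounds/andP[a1 a2] /action_bounds/andP[b1 b2].
have := rates_sum1 m; have := lambda_gt0 m; have := beta_gt0 m.
by have := mu1_gt0 m => *; rewrite ler_norml; apply/andP; split; lra.
Qed.

Lemma cost_dist_le phi i : Phi m phi ->
  `|cost m phi (i, false) - cost m phi (i, true)| <= crate m (mu2 m).
Proof.
move=> [/(_ i) h1 _]; have c1 := crate_mu1 m; have c2 := crate_mu2_gt0 m.
rewrite /cost /= ler_norml; apply/andP.
by case: h1 => ->; case: (mu_choice m) => ->; split; rewrite ?c1; lra.
Qed.

(* The total cost difference between the two starting states over horizon [N]
   is [H (i, 0) - D N i], where [D] performs value iteration for [phi], up to
   an error governed by the geometrically vanishing increments of the N-step
   expectation of [H]. *)
Lemma saved_cost_fixpoint phi : Phi m phi -> exists w : nat -> R,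
  [/\ exists2 B, 0 <= B & forall i, `|w i| <= B * zeta ^+ i,
      forall i, w i = auxQ m H w i (phi (i, true))
    & forall i, saved_cost m phi i = H (i, false) - w i].
Proof.
move=> Pphi; have [hact _] := Pphi.
have z1 := zeta_gt1 Hzeta; have zX0 := zetaX_gt0 Hzeta.
have zX1 := zetaX_ge1 Hzeta; have z0 : 0 <= zeta by lra.
have l0 := disc_gt0 Hzeta; have l1 := disc_lt1 Hzeta.
have k0 := kill_ge0 Hzeta; have k1 := kill_lt1 Hzeta.
have [C C0 hC] := H_increment_bound phi.
pose S N x := \sum_(0 <= n < N) chain_expectation m phi x n (cost m phi).
pose F N := iter N (step m phi) H.
have FE N : F N.+1 = step m phi (F N) by [].
have SE N x : S N.+1 x = cost m phi x + step m phi (S N) x.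
  exact: sum_chain_expectationS.
(* The Poisson equation telescoped over [N] steps. *)
have S_false N i : S N (i, false) = gstar m * N%:R + H (i, false) - F N (i, false).
  elim: N i => [|N IH] i; first by rewrite /S big_geq // /F /= mulr0; ring.
  have := poisson phi i; rewrite SE FE -natr1 /step /= !IH.
  by lra.
pose D N i := H (i, false) - (S N (i, false) - S N (i, true)).
(* At level 1 service has rate [phi (i, true)], whereas [F N] is propagated with rate [mu m]; the
   mismatch leaves one increment of [F N]. *)
pose e N i := (phi (i, true) - mu m) * (0 < i)%N%:R
  * (F N (i, false) - F N (i.-1, false)).
have DS N i : D N.+1 i = auxQ m H (D N) i (phi (i, true)) + e N i.
  rewrite [LHS]/D S_false SE FE -natr1 /auxQ /e /step /=.
  have ST j : S N (j, true) = D N j - H (j, false)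
      + (gstar m * N%:R + H (j, false) - F N (j, false)).
    by rewrite /D S_false; ring.
  by rewrite !ST !S_false /cost /=; ring.
have e_le N i : `|e N i| <= C * kill m zeta ^+ N * zeta ^+ i.
  have X0 j : 0 <= C * kill m zeta ^+ N * zeta ^+ j.
    by rewrite !mulr_ge0 ?exprn_ge0.
  case: i => [|i]; first by rewrite /e mulr0 mul0r normr0.
  rewrite /e mulr1 normrM; have a1 := action_dist_le1 (hact i.+1) (action_mu m).
  apply: le_trans (ler_pM (normr_ge0 _) (normr_ge0 _) a1 (hC N i)) _.
  by rewrite mul1r exprS ler_wpM2l ?mulr_ge0 ?exprn_ge0 // ler_peMl // ltW.
(* The midpoint between this maximum and 1: at least the decay rate of [e], and strictly above
   [disc], which leaves room to absorb [e]. *)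
pose q := (Num.max (disc m zeta) (kill m zeta) + 1) / 2.
have [lq kq q1] : [/\ disc m zeta < q, kill m zeta <= q & q < 1].
  have M1 : Num.max (disc m zeta) (kill m zeta) < 1 by rewrite gt_max l1.
  have Ml : disc m zeta <= Num.max (disc m zeta) (kill m zeta).
    by rewrite le_max lexx.
  have Mk : kill m zeta <= Num.max (disc m zeta) (kill m zeta).
    by rewrite le_max lexx orbT.
  by rewrite /q; split; lra.
have q0 : 0 <= q by lra.
(* The first summand bounds [D 1 - D 0]; the second gives [Bstep], where [2 * C] accounts for the
   two error terms in [e N.+1 i - e N i]. *)
pose B := crate m (mu2 m) + 2 * C / (q - disc m zeta).
have B2 : 2 * C / (q - disc m zeta) <= B.
  by rewrite lerDr ltW // crate_mu2_gt0.
have B0 : 0 <= B by apply: le_trans B2; rewrite divr_ge0 ?subr_ge0 ?mulr_ge0 // ltW.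
have Bstep : disc m zeta * B + 2 * C <= q * B.
  by move: B2; rewrite ler_pdivrMr ?subr_gt0 //; lra.
have D_incr i N : `|D N.+1 i - D N i| <= B * zeta ^+ i * q ^+ N.
  elim: N i => [|N IH] i.
    have S1 x : S 1%N x = cost m phi x.
      by rewrite /S big_nat1 chain_expectation_iter.
    have S0 x : S 0%N x = 0 by rewrite /S big_geq.
    rewrite expr0 mulr1 /D !S1 !S0 (_ : _ - _ =
      - (cost m phi (i, false) - cost m phi (i, true))); last by ring.
    rewrite normrN; apply: le_trans (cost_dist_le i Pphi) _.
    apply: le_trans (_ : B <= _); last by rewrite ler_peMr.
    by rewrite lerDl divr_ge0 ?subr_ge0 ?mulr_ge0 // ltW.
  rewrite !(DS _ i) (_ : _ - _ = (auxQ m H (D N.+1) i (phi (i, true))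
     - auxQ m H (D N) i (phi (i, true))) + (e N.+1 i - e N i)); last by ring.
  apply: le_trans (ler_normD _ _) _.
  have X0 : 0 <= q ^+ N * zeta ^+ i by rewrite mulr_ge0 ?exprn_ge0 // ltW.
  have eN M : (N <= M)%N -> `|e M i| <= C * (q ^+ N * zeta ^+ i).
    move=> NM; apply: le_trans (e_le M i) _.
    rewrite -mulrA ler_wpM2l // ler_wpM2r ?(ltW (zX0 i)) //.
    apply: le_trans (_ : q ^+ M <= _); first by rewrite lerXn2r ?nnegrE.
    by rewrite ler_wiXn2l // ltW.
  have h : `|auxQ m H (D N.+1) i (phi (i, true))
      - auxQ m H (D N) i (phi (i, true))| <= disc m zeta * (B * q ^+ N) * zeta ^+ i.
    apply: auxQ_contract_norm => //; first by rewrite mulr_ge0 ?exprn_ge0.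
    by move=> j; rewrite mulrAC.
  have h2 := le_trans (ler_normB _ _) (lerD (eN _ (leqnSn N)) (eN _ (leqnn N))).
  apply: le_trans (lerD h h2) _; rewrite [q ^+ N.+1]exprS.
  by have := ler_wpM2r X0 Bstep; lra.
have Dcvg i := geometric_increments_cvg q0 q1 (D_incr i).
pose w i := limn (fun N => D N i).
have Dw i : ((fun N => D N i) @ \oo --> w i)%classic by case: (Dcvg i).
have [CH CH0 hCH] := H_bound.
exists w; split.
- exists (CH + B / (1 - q)) => [|i].
    by rewrite addr_ge0 ?divr_ge0 ?subr_ge0 // ltW.
  have D0 : D 0%N i = H (i, false) by rewrite /D /S !big_geq // subrr subr0.
  have [_] := Dcvg i; rewrite -/(w i) D0 => h.
  rewrite -[w i](subrK (H (i, false))) mulrDl addrC.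
  apply: le_trans (ler_normD _ _) (lerD (hCH i) _).
  by apply: le_trans h _; rewrite mulrAC.
(* The recursion [DS] passes to the limit, since [auxQ] involves only three values of [D N] and [e]
   vanishes. *)
- move=> i; apply/esym; set a := phi _.
  have e0 : ((fun N => e N i) @ \oo --> 0)%classic.
    apply/norm_cvg0P; apply: (@squeeze_cvgr _ _ _ _ (fun=> 0)
      (geometric (C * zeta ^+ i) (kill m zeta))).
    + by apply: nearW => N; rewrite normr_ge0 /= mulrAC e_le.
    + exact: cvg_cst.
    + by apply: cvg_geometric; rewrite ger0_norm.
  have Dlim : ((fun N => auxQ m H (D N) i a + e N i) @ \oo -->
      auxQ m H w i a + 0)%classic.
    apply: cvgD => //; rewrite /auxQ.
    apply: cvgD; last by apply: cvgM => //; exact: cvg_cst.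
    apply: cvgD; last by apply: cvgM => //; exact: cvg_cst.
    apply: cvgD; last by apply: cvgM => //; exact: cvg_cst.
    exact: cvg_cst.
  have DSw : ((fun N => D N.+1 i) @ \oo --> w i)%classic.
    by rewrite (cvg_shiftS (fun N => D N i)).
  have DSE : (fun N => D N.+1 i) = (fun N => auxQ m H (D N) i a + e N i).
    by apply: funext => N; exact: DS.
  rewrite -DSE addr0 in Dlim.
  exact: (@cvg_unique _ (@Rhausdorff R) _ _ _ _ Dlim DSw).
- move=> i; rewrite /saved_cost.
  apply: (cvg_lim (@Rhausdorff R)).
  have -> : series (fun n => chain_expectation m phi (i, false) n (cost m phi)
        - chain_expectation m phi (i, true) n (cost m phi))
      = (fun N => H (i, false) - D N i).
    by apply: funext => N; rewrite /series /= sumrB /D subKr.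
  by apply: cvgB => //; exact: cvg_cst.
Qed.

End AuxiliaryModel.

(** * Explicit constants for [H] and for the first iterate *)

Section Bounds.
Variables (R : realType) (m : model R) (zeta : R) (H : state -> R) (uM : R).
Hypotheses (Hzeta : zeta_admissible m zeta) (HH : is_Hstar m zeta H).
Hypothesis HuM : uM_bound m zeta uM.

Lemma policy_of_Phi f : (forall i, action m (f i)) -> Phi m (policy_of m f).
Proof. by []. Qed.

Lemma crate_ge0 a : action m a -> 0 <= crate m a.
Proof.
by case=> ->; rewrite ?crate_mu1 // ltW // crate_mu2_gt0.
Qed.

Lemma gstar_ge0 : 0 <= gstar m.
Proof.
have l0 := lambda_gt0 m; have lm := lambda_lt_mu m.
have mu0 : 0 < mu m by lra.
have r0 : 0 < rho m by rewrite divr_gt0.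
have r1 : rho m < 1 by rewrite ltr_pdivrMr // mul1r.
rewrite addr_ge0 ?crate_ge0 ?mulr_ge0 ?subr_ge0 ?(ltW r1) //; first exact: mu_choice.
apply: limr_ge; first exact: hcost_pseries.
apply: nearW => n; rewrite /series /= sumr_ge0 // => i _.
by rewrite mulr_ge0 ?hcost_ge0 // exprn_ge0 // ltW.
Qed.

Lemma uM_gstar x : gstar m <= uM * weight zeta x.
Proof.
move: HuM; rewrite /uM_bound ge_max => /andP[_ hg].
by apply: le_trans (Mnorm_le Hzeta hg x); rewrite ler_norm.
Qed.

Lemma uM_cost phi x : Phi m phi -> `|cost m phi x| <= uM * weight zeta x.
Proof.
move=> Pphi; move: HuM; rewrite /uM_bound ge_max => /andP[hc _].
apply: (Mnorm_le Hzeta); apply: le_trans hc.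
by apply: ereal_sup_ubound; exists phi.
Qed.

Lemma uM_gt0 : 0 < uM.
Proof.
have Pphi : Phi m (policy_of m (fun=> mu2 m)) by apply: policy_of_Phi => i; right.
have := uM_cost (0%N, true) Pphi; rewrite /weight /cost /= expr0 mulr1 hcost0 addr0.
by apply: lt_le_trans; rewrite normr_gt0 gt_eqF // crate_mu2_gt0.
Qed.

Lemma Ktilde_gt0 : 0 < Ktilde m zeta uM.
Proof.
have u0 := uM_gt0; have e1 := eta_lt1 Hzeta; have b0 := beta_gt0 m.
rewrite ltr_wpDr ?ltr_wpDl ?gstar_ge0 //.
by rewrite divr_ge0 ?mulr_ge0 ?subr_ge0 // ltW.
Qed.

(* As [H (0, 0) = 0], only the chain killed at the origin matters. *)
Lemma Hstar_bound i : `|H (i, false)| <= uM / 2 / (1 - eta m zeta) * zeta ^+ i.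
Proof.
have u0 := uM_gt0; have e1 := eta_lt1 Hzeta; have zX0 := zetaX_gt0 Hzeta.
have k0 := kill_ge0 Hzeta; have k1 := kill_lt1 Hzeta; have ke := kill_le_eta Hzeta.
have z1 := zeta_gt1 Hzeta; have [_ H00 _] := HH.
apply: le_trans (_ : uM / 2 / (1 - kill m zeta) * zeta ^+ i <= _); last first.
  rewrite ler_pM2r // ler_pM2l ?divr_gt0 // lef_pV2 ?posrE ?subr_gt0 //.
  by rewrite lerD2l lerN2.
apply: (@contraction_bound _ _ (fun i => H (i, false)) (fun i => zeta ^+ i)) => //.
- by rewrite divr_ge0 // ltW.
- by move=> j; rewrite ltW.
- exact: H_bound Hzeta HH.
move=> B B0 hB [|j].
  by rewrite H00 normr0 mulr_ge0 ?addr_ge0 ?mulr_ge0 ?invr_ge0 // ltW.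
have l0 := lambda_gt0 m; have lm := lambda_lt_mu m; have sum1 := rates_sum1 m.
have b0 := beta_gt0 m; have m10 := mu1_gt0 m.
have /andP[_ mm2] := action_bounds (action_mu m).
have rest0 : 0 <= 1 - lambda m - mu m by lra.
have mu0 : 0 <= mu m by lra.
have Pphi : Phi m (policy_of m (fun=> mu m)).
  by apply: policy_of_Phi => _; exact: mu_choice.
have hd k c : 0 <= c -> c * `|H (k, false)| <= c * (B * zeta ^+ k).
  by move=> c0; rewrite ler_wpM2l.
(* Cost and [gstar] both lie between 0 and [uM / 2 * zeta ^+ j.+1], hence so does their distance;
   the half is the level-0 weight. *)
have hc : `|cost m (policy_of m (fun=> mu m)) (j.+1, false) - gstar m|
    <= uM / 2 * zeta ^+ j.+1.
  have := uM_cost (j.+1, false) Pphi; have := uM_gstar (j.+1, false).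
  have g0 := gstar_ge0; have c0 := crate_ge0 (action_mu m).
  have h0 := hcost_ge0 m j.+1.
  rewrite /weight /cost /= ger0_norm ?addr_ge0 // => ? ?.
  by rewrite ler_norml; apply/andP; split; lra.
have := poisson HH (policy_of m (fun=> mu m)) j.+1.
rewrite /step /= => pois.
rewrite (_ : H (j.+1, false) = (cost m (policy_of m (fun=> mu m)) (j.+1, false)
  - gstar m) + (lambda m * H (j.+2, false) + mu m * H (j, false)
     + (1 - lambda m - mu m) * H (j.+1, false))); last by lra.
apply: le_trans (ler_normD _ _) _; rewrite [leRHS]mulrDl lerD //.
apply: le_trans (ler_normD _ _) _; apply: le_trans (lerD (ler_normD _ _) (lexx _)) _.
rewrite !normrM (ger0_norm (ltW l0)) (ger0_norm rest0) (ger0_norm mu0).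
apply: le_trans (lerD (lerD (hd _ _ (ltW l0)) (hd _ _ mu0)) (hd _ _ rest0)) _.
rewrite le_eqVlt; apply/orP; left; apply/eqP.
by rewrite /kill !exprS; field; lra.
Qed.

(** The summands of [Ktilde] pay in turn for [gstar], for the cost and for [beta m * H];
    [Hstar_bound] gives half of the last. *)
Lemma auxQ0_bound a i : action m a ->
  `|auxQ m H (fun=> 0) i a| <= Ktilde m zeta uM * zeta ^+ i.
Proof.
move=> ha; have Pphi : Phi m (policy_of m (fun=> a)) by exact: policy_of_Phi.
have b0 := beta_gt0 m; have g0 := gstar_ge0; have u0 := uM_gt0.
have e1 := eta_lt1 Hzeta; have zX1 := zetaX_ge1 Hzeta i.
have hc := uM_cost (i, true) Pphi.
rewrite (_ : auxQ _ _ _ _ _ = cost m (policy_of m (fun=> a)) (i, true)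
   - gstar m + beta m * H (i, false)); last by rewrite /auxQ /cost /=; ring.
apply: le_trans (ler_normD _ _) _; apply: le_trans (lerD (ler_normB _ _) (lexx _)) _.
rewrite (ger0_norm g0) normrM (gtr0_norm b0) /Ktilde.
have hH := ler_wpM2l (ltW b0) (Hstar_bound i).
have hg : gstar m <= gstar m * zeta ^+ i by rewrite ler_peMr.
have pos : 0 <= beta m * uM / (1 - eta m zeta) * zeta ^+ i.
  by rewrite mulr_ge0 ?divr_ge0 ?mulr_ge0 ?subr_ge0 // ltW // (zetaX_gt0 Hzeta).
have e : beta m * (uM / 2 / (1 - eta m zeta) * zeta ^+ i)
  = beta m * uM / (1 - eta m zeta) * zeta ^+ i / 2 by field; lra.
by move: hc; rewrite /weight /=; lra.
Qed.

(** * Error bounds for value iteration and the choice of the stage *)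

Local Notation K := (Ktilde m zeta uM).
Local Notation q := (disc m zeta).

Lemma auxV_le n i a : action m a -> auxV m H n.+1 i <= auxQ m H (auxV m H n) i a.
Proof. by case=> -> /=; rewrite ge_min lexx ?orbT. Qed.

Lemma auxV_attained n i :
  exists2 a, action m a & auxV m H n.+1 i = auxQ m H (auxV m H n) i a.
Proof.
rewrite /=; have [le|lt] := leP (auxQ m H (auxV m H n) i (mu1 m))
                               (auxQ m H (auxV m H n) i (mu2 m)).
  by exists (mu1 m) => //; left.
by exists (mu2 m) => //; right.
Qed.

(** An action attaining one of the two minima is a candidate for the other, so either difference is
    bounded at a common action. *)
Lemma auxV_increment n i :
  `|auxV m H n.+1 i - auxV m H n i| <= q ^+ n * K * zeta ^+ i.
Proof.
have q0 := disc_gt0 Hzeta; have K0 := Ktilde_gt0.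
elim: n i => [|n IH] i.
  have [a ha ->] := auxV_attained 0 i; rewrite expr0 mul1r subr0.
  exact: auxQ0_bound.
have B0 : 0 <= q ^+ n * K by rewrite mulr_ge0 ?exprn_ge0 // ltW.
rewrite exprS -(mulrA q) ler_norml; apply/andP; split.
- have [a ha ->] := auxV_attained n.+1 i.
  rewrite lerNl opprB; apply: le_trans (lerB (auxV_le n i ha) (lexx _)) _.
  apply: auxQ_contract => // j; apply: le_trans (IH j).
  by rewrite distrC ler_norm.
- have [a ha ->] := auxV_attained n i.
  apply: le_trans (lerB (auxV_le n.+1 i ha) (lexx _)) _.
  by apply: auxQ_contract => // j; apply: le_trans (IH j); rewrite ler_norm.
Qed.

(** One-sided because value iteration minimises at each stage while [w] keeps to [pi]. At stage 0
    the claim is the norm bound [K / (1 - q)] on [w] itself. *)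
Lemma fixpoint_ge_auxV (pi w : nat -> R) n i :
  (forall i, action m (pi i)) ->
  (exists2 B, 0 <= B & forall i, `|w i| <= B * zeta ^+ i) ->
  (forall i, w i = auxQ m H w i (pi i)) ->
  auxV m H n i - w i <= q ^+ n * (K / (1 - q)) * zeta ^+ i.
Proof.
move=> hpi wB wE; have q0 := disc_gt0 Hzeta; have q1 := disc_lt1 Hzeta.
have K0 := Ktilde_gt0; have zX0 := zetaX_gt0 Hzeta.
have C0 : 0 <= K / (1 - q) by rewrite divr_ge0 ?subr_ge0 // ltW.
elim: n i => [|n IH] i.
  rewrite expr0 mul1r sub0r; apply: le_trans (ler_norm _) _; rewrite normrN.
  apply: (contraction_bound _ _ q1 (fun j => ltW (zX0 j)) wB); try exact: ltW.
  move=> B B0 hB j; rewrite wE mulrDl.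
  rewrite -[auxQ _ _ w _ _](subrK (auxQ m H (fun=> 0) j (pi j))) [X in `|X|]addrC.
  apply: le_trans (ler_normD _ _) (lerD (auxQ0_bound _ _) _) => //.
  by apply: auxQ_contract_norm => // k; rewrite subr0.
rewrite wE exprS -(mulrA q); apply: le_trans (lerB (auxV_le n i (hpi i)) (lexx _)) _.
by apply: auxQ_contract => //; rewrite mulr_ge0 ?exprn_ge0 // ltW.
Qed.

(** The operator of [pi] maps the iterate before stage [n] to the one at stage [n]; a nearly fixed
    function is close to the fixed point of a contraction. *)
Lemma stage_optimal_fixpoint_dist (pi w : nat -> R) n i :
  stage_optimal m H n pi ->
  (exists2 B, 0 <= B & forall i, `|w i| <= B * zeta ^+ i) ->
  (forall i, w i = auxQ m H w i (pi i)) ->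
  `|w i - auxV m H n i| <= q ^+ n * (K / (1 - q)) * zeta ^+ i.
Proof.
case: n => [|n] [//= _ hpi] [B B0 hB] wE.
have q0 := disc_gt0 Hzeta; have q1 := disc_lt1 Hzeta.
have K0 := Ktilde_gt0; have zX0 := zetaX_gt0 Hzeta.
have VE j : auxV m H n.+1 j = auxQ m H (auxV m H n) j (pi j).
  apply/le_anti/andP; split; first by apply: auxV_le; exact: (hpi j).1.
  have [a ha ->] := auxV_attained n j; exact: (hpi j).2.
have qn0 : 0 <= q ^+ n by rewrite exprn_ge0 // ltW.
have step B1 j : 0 <= B1 -> (forall i, `|w i - auxV m H n i| <= B1 * zeta ^+ i) ->
    `|w j - auxV m H n.+1 j| <= q * B1 * zeta ^+ j.
  by move=> B10 hB1; rewrite VE wE; apply: auxQ_contract_norm => //; exact: (hpi j).1.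
have Vbound : exists2 B, 0 <= B & forall j, `|auxV m H n j| <= B * zeta ^+ j.
  elim: (n) => [|k [B1 B10 hB1]].
    by exists 0 => // j; rewrite normr0 mul0r.
  exists (q ^+ k * K + B1) => [|j].
    by rewrite addr_ge0 // mulr_ge0 ?exprn_ge0 // ltW.
  rewrite -[auxV _ _ k.+1 j](subrK (auxV m H k j)) mulrDl.
  exact: le_trans (ler_normD _ _) (lerD (auxV_increment k j) (hB1 j)).
have dist : forall j, `|w j - auxV m H n j| <= q ^+ n * K / (1 - q) * zeta ^+ j.
  apply: contraction_bound => //; try exact: ltW; first by rewrite mulr_ge0 // ltW.
  - by move=> j; rewrite ltW.
  - have [B1 B10 hB1] := Vbound; exists (B + B1) => [|j]; first by rewrite addr_ge0.
    by rewrite mulrDl; apply: le_trans (ler_normB _ _) (lerD (hB j) (hB1 j)).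
  - move=> B1 B10 hB1 j; rewrite [leRHS]mulrDl [leRHS]addrC.
    rewrite -[w j](subrK (auxV m H n.+1 j)) -[X in `|X|]addrA.
    exact: le_trans (ler_normD _ _) (lerD (step _ _ B10 hB1) (auxV_increment n j)).
(* [dist] concerns the iterate before the stage; one more application of the operator of [pi] gains
   the missing factor [q]. *)
rewrite exprS -(mulrA q); apply: step => //.
- by rewrite mulr_ge0 // divr_ge0 ?subr_ge0 // ltW.
- by move=> j; have := dist j; rewrite mulrA.
Qed.

Lemma ntilde_bound eps i : 0 < eps ->
  q ^+ ntilde m zeta uM eps i * (K / (1 - q)) * zeta ^+ i <= eps.
Proof.
move=> e0; have q0 := disc_gt0 Hzeta; have q1 := disc_lt1 Hzeta.
have K0 := Ktilde_gt0; have zX0 := zetaX_gt0 Hzeta i.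
have q1' : 0 < 1 - q by rewrite subr_gt0.
set n := ntilde _ _ _ _ _; pose y := eps * (1 - q) / (K * zeta ^+ i).
have y0 : 0 < y by rewrite divr_gt0 ?mulr_gt0.
suff qy : q ^+ n <= y.
  rewrite -mulrA -ler_pdivlMr; last by rewrite mulr_gt0 // divr_gt0.
  apply: le_trans qy _; rewrite le_eqVlt; apply/orP; left; apply/eqP.
  by rewrite /y; field; rewrite ?(gt_eqF K0) ?(gt_eqF q1') ?(gt_eqF zX0).
(* In the default case [ntilde] is 1, which still dominates the logarithm, then at most 0. Below,
   [ln q < 0] reverses the inequality. *)
have logn : logb q y <= n%:R.
  rewrite /n /ntilde -/q -/y; case: ifP => [c0|/negbT].
    have /= := ceil_ge (logb q y); move: c0; case: (Num.ceil _) => // k.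
  by rewrite -leNgt => c0; apply: le_trans (ceil_ge _) _; rewrite (le_trans (_ : _ <= 0)) // lerz0.
rewrite -ler_ln ?posrE ?exprn_gt0 // lnXn //.
by move: logn; rewrite /logb ler_ndivrMr ?ln_lt0 ?q0 // mulr_natl.
Qed.

End Bounds.

Unset Implicit Arguments.

Theorem proposition5p1 (R : realType) (m : model R)
    (zeta : R) (Hzeta : zeta_admissible m zeta)
    (H : state -> R) (HH : is_Hstar m zeta H)
    (uM : R) (HuM : uM_bound m zeta uM)
    (eps : R) (Heps : 0 < eps) (i : nat)
    (f : nat -> R)
    (Hf : stage_optimal m H (ntilde m zeta uM (eps / 2) i) f) :
  Phi m (policy_of m f) /\
  (opt_saved_cost m i - eps%:E <= (saved_cost m (policy_of m f) i)%:E)%E.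
Proof.
have Pf : Phi m (policy_of m f).
  by apply: policy_of_Phi => j; exact: (Hf.2 j).1.
split=> //; rewrite leeBlDr //; apply: ge_ereal_sup => _ [phi Pphi <-].
rewrite -EFinD lee_fin.
(* Both saved costs are [H (i, false)] minus a fixed point, so the claim becomes
   [v i <= w i + eps]. *)
have [w [wB wE ->]] := saved_cost_fixpoint Hzeta HH Pphi.
have [v [vB vE ->]] := saved_cost_fixpoint Hzeta HH Pf.
have e20 : 0 < eps / 2 by lra.
have := ntilde_bound Hzeta HuM i e20.
move: (ntilde _ _ _ _ _) Hf => n Hf he.
(* Both comparisons pass through the same value [auxV m H n i], each at a cost of at most
   [eps / 2]. *)
have hv := le_trans (ler_norm _) (stage_optimal_fixpoint_dist Hzeta HH HuM i Hf vB vE).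
have hw := fixpoint_ge_auxV Hzeta HH HuM n i Pphi.1 wB wE.
move: he hv hw; move: (_ * zeta ^+ i) (auxV _ _ _ _) => d V *; lra.
Qed.
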